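(* Let $G=(V,E,m,\mu)$ be a weighted graph. For every function $f:V\to\mathbb{R}$ and every $x\in V$, $$\Gamma_2(f)(x)=\frac14 |D^2 f|^2(x)+\frac12(\Delta f (x))^2-\frac14\sum_{y\sim x}\frac{\mu_{xy}}{m_x}(\mathrm{D}_x+\mathrm{D}_y)|f(y)-f(x)|^2,$$ where $$|D^2 f|^2(x):=\sum_{\substack{y,z\in V\\ y\sim x,\ z\sim y}}\frac{\mu_{xy}\mu_{yz}}{m_xm_y}|f(x)-2f(y)+f(z)|^2$$ (the choice $z=x$ is included in the sum).
   Context: A weighted graph $G=(V,E,m,\mu)$ consists of an undirected, connected, locally finite, simple graph $(V,E)$ (finite or infinite, with more than one vertex), a vertex weight $m:V\to(0,\infty)$, $x\mapsto m_x$, and a symmetric edge weight $\mu:E\to(0,\infty)$, $\{x,y\}\mapsto\mu_{xy}=\mu_{yx}$. Write $x\sim y$ if $\{x,y\}\in E$. The weighted vertex degree is $\mathrm{D}_x=\frac{1}{m_x}\sum_{y\sim x}\mu_{xy}$. For functions $f,g:V\to\mathbb{R}$ the Laplacian is $\Delta f(x)=\frac{1}{m_x}\sum_{y\sim x}\mu_{xy}(f(y)-f(x))$, the gradient form is $\Gamma(f,g)=\frac12(\Delta(fg)-f\Delta g-g\Delta f)$, that is, $\Gamma(f,g)(x)=\frac{1}{2m_x}\sum_{y\sim x}\mu_{xy}(f(y)-f(x))(g(y)-g(x))$, with $\Gamma(f)=\Gamma(f,f)$, and the iterated gradient form is $\Gamma_2(f,g)=\frac12(\Delta\Gamma(f,g)-\Gamma(f,\Delta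 g)-\Gamma(g,\Delta f))$, with $\Gamma_2(f)=\Gamma_2(f,f)=\frac12\Delta\Gamma(f)-\Gamma(f,\Delta f)$. *)

(* Defs.v *)
From mathcomp Require Import all_boot all_order all_algebra.
From mathcomp Require Import classical_sets cardinality fsbigop reals.

Set Implicit Arguments.
Unset Strict Implicit.
Unset Printing Implicit Defensive.

Import Order.TTheory GRing.Theory Num.Theory.

Local Open Scope classical_set_scope.
Local Open Scope ring_scope.

(* The edge weight is a function on ordered pairs; it is constrained, and used,
   only on pairs of adjacent vertices. *)
Record weighted_graph (R : realType) (V : choiceType) := WeightedGraph {
  adj : rel V;
  vweight : V -> R;
  eweight : V -> V -> R;
  adj_sym : forall x y, adj x y -> adj y x;
  adj_irr : forall x, ~ adj x x;
  adj_locally_finite : forall x, finite_set [set y | adj x y];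
  adj_connected : forall x y, exists p : seq V, path adj x p /\ last x p = y;
  more_than_one_vertex : exists x y : V, x <> y;
  vweight_gt0 : forall x, 0 < vweight x;
  eweight_gt0 : forall x y, adj x y -> 0 < eweight x y;
  eweight_sym : forall x y, adj x y -> eweight x y = eweight y x
}.

Section Operators.
Context {R : realType} {V : choiceType} (G : weighted_graph R V).
Implicit Types (f g : V -> R) (x y z : V).

(* The finitely supported sums below are genuine sums: their index sets are
   finite by local finiteness. *)
Definition nbhd x : set V := [set y | adj G x y].

Definition wdegree x : R :=
  (vweight G x)^-1 * \sum_(y \in nbhd x) eweight G x y.

Definition laplacian f x : R :=
  (vweight G x)^-1 * \sum_(y \in nbhd x) eweight G x y * (f y - f x).

Definition Gamma f g x : R :=
  2^-1 * (laplacian (f \* g) x - f x * laplacian g x - g x * laplacian f x).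

Definition Gamma2 f g x : R :=
  2^-1 * (laplacian (Gamma f g) x - Gamma f (laplacian g) x
          - Gamma g (laplacian f) x).

Definition hessian_sq f x : R :=
  \sum_(p \in [set p : V * V | adj G x p.1 /\ adj G p.1 p.2])
    (eweight G x p.1 * eweight G p.1 p.2) / (vweight G x * vweight G p.1)
    * `|f x - 2 * f p.1 + f p.2| ^+ 2.

End Operators.

(* Main.v *)
Require Import Defs.
From mathcomp Require Import all_boot all_order all_algebra.
From mathcomp Require Import finmap ring.
From mathcomp Require Import classical_sets cardinality fsbigop reals.

Import Order.TTheory GRing.Theory Num.Theory.
Local Open Scope classical_set_scope.
Local Open Scope ring_scope.

(** Everything takes place in a single weighted sum over the neighbours of
    [x].  Write [P_x h = (1 / m_x) \sum_(y ~ x) mu_xy h(y)], a linear functional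
    of [h] with [P_x 1 = D_x].  In terms of the increment [a(y) = f y - f x],
    one has [laplacian f x = P_x a] and [2 * Gamma f f x = P_x (a ^ 2)]
    ([GammaE]).

    The second-order difference along a path [x ~ y ~ z] is itself a difference
    of increments, [f x - 2 f y + f z = (f z - f y) - a(y)].  Expanding its
    square and summing over [z] with [P_y] gives
    [2 Gamma f f y - 2 a(y) laplacian f y + a(y) ^ 2 D_y]
    ([weighted_sum_second_difference]).  Hence a quarter of [hessian_sq] is [P_x]
    of a quarter of this expression, and it contains the two terms of
    [Gamma2 f f x] that look beyond the neighbours of [x], namely
    [P_x (Gamma f f) / 2] and [- P_x (a * laplacian f) / 2].

    What is left over is local.  Since the Laplacian and [Gamma] at [x]
    only see the increments of [Gamma f f] and [laplacian f], [Gamma2 f f x]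
    also contains [P_x (a * laplacian f x) / 2 = (laplacian f x) ^ 2 / 2] and
    [- P_x (Gamma f f x) / 2 = - D_x P_x (a ^ 2) / 4] ([Gamma2E]).  A quarter of
    the squared Hessian has the extra term [P_x (D_y a ^ 2) / 4]
    ([hessian_sqE]), which must be subtracted again; together with
    [- D_x P_x (a ^ 2) / 4] this is the degree correction in the formula
    ([degree_correctionE]). *)

(** The index set of the squared Hessian is a dependent product (the range of
    [z] depends on [y]), so its sum is iterated by this lemma. *)
Lemma fsbig_setXR (R : Type) (idx : R) (op : Monoid.com_law idx)
    (I J : choiceType) (A : set I) (B : I -> set J) (F : I * J -> R) :
  finite_set A -> (forall i, A i -> finite_set (B i)) ->
  \big[op/idx]_(p \in A `*`` B) F p =
  \big[op/idx]_(i \in A) \big[op/idx]_(j \in B i) F (i, j).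
Proof.
move=> Afin Bfin.
pose r := [seq (i, j) | i <- fset_set A, j <- fset_set (B i)].
have r_uniq : uniq r.
  by apply: allpairs_uniq_dep => // [[i j] [i' j'] _ _ [-> ->]].
have -> : A `*`` B = [set` r].
  apply/seteqP; split => [[i j] [/= Ai Bij]|[i j] /=].
    by apply/allpairsPdep; exists i, j; rewrite !in_fset_set ?inE //; exact: Bfin.
  move=> /allpairsPdep [i' [j' [Ai' Bj' [-> ->]]]].
  move: Ai'; rewrite in_fset_set // inE => Ai'.
  by move: Bj'; rewrite in_fset_set ?inE //; exact: Bfin.
rewrite -fsbig_seq // big_allpairs_dep [RHS]fsbig_finite //.
apply: eq_big_seq => i; rewrite in_fset_set // inE => Ai.
by rewrite fsbig_finite //; exact: Bfin.
Qed.

Section GammaCalculus.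
Context {R : realType} {V : choiceType} (G : weighted_graph R V).
Implicit Types (f g h k : V -> R) (x y z : V) (c : R).

Definition weighted_sum x h : R :=
  (vweight G x)^-1 * \sum_(y \in nbhd G x) eweight G x y * h y.

Lemma finite_nbhd x : finite_set (nbhd G x).
Proof. exact: adj_locally_finite. Qed.

Lemma eq_weighted_sum x h k : h =1 k -> weighted_sum x h = weighted_sum x k.
Proof.
by move=> hk; congr (_ * _); apply: eq_fsbigr => y _; rewrite hk.
Qed.

Lemma weighted_sumD x h k :
  weighted_sum x (fun y => h y + k y) = weighted_sum x h + weighted_sum x k.
Proof.
rewrite /weighted_sum -mulrDr; congr (_ * _).
rewrite -fsbig_split; last exact: finite_nbhd.
by apply: eq_fsbigr => y _; rewrite mulrDr.
Qed.

Lemma weighted_sumZ x c h :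
  weighted_sum x (fun y => c * h y) = c * weighted_sum x h.
Proof.
rewrite /weighted_sum mulrCA; congr (_ * _).
by rewrite mulr_fsumr; apply: eq_fsbigr => y _; rewrite mulrCA.
Qed.

Lemma weighted_sum_cst x c : weighted_sum x (fun=> c) = c * wdegree G x.
Proof.
rewrite (@eq_weighted_sum x _ (fun=> c * 1)); last by move=> y; rewrite mulr1.
rewrite weighted_sumZ; congr (_ * (_ * _)).
by apply: eq_fsbigr => y _; rewrite mulr1.
Qed.

Lemma weighted_sumB x h k :
  weighted_sum x (fun y => h y - k y) = weighted_sum x h - weighted_sum x k.
Proof.
rewrite -[- weighted_sum x k]mulN1r -weighted_sumZ -weighted_sumD.
by apply: eq_weighted_sum => y; rewrite mulN1r.
Qed.

Lemma laplacianE f x :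
  laplacian G f x = weighted_sum x (fun y => f y - f x).
Proof. by []. Qed.

Lemma GammaE f g x :
  Gamma G f g x = 2^-1 * weighted_sum x (fun y => (f y - f x) * (g y - g x)).
Proof.
rewrite /Gamma !laplacianE; congr (_ * _).
rewrite -!mulNr -!weighted_sumZ -!weighted_sumD.
by apply: eq_weighted_sum => y /=; ring.
Qed.

(** The second difference is [b - a] with [a = f y - f x] and [b = f z - f y];
    the three terms come from [b ^ 2], [- 2 a b] and [a ^ 2], where [a] is
    constant in [z]. *)
Lemma weighted_sum_second_difference f x y :
  weighted_sum y (fun z => (f x - 2 * f y + f z) ^+ 2) =
  2 * Gamma G f f y - 2 * (f y - f x) * laplacian G f y
  + (f y - f x) ^+ 2 * wdegree G y.
Proof.
rewrite GammaE mulrA divff ?pnatr_eq0 // mul1r laplacianE -[in RHS]mulNr.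
rewrite -weighted_sum_cst -weighted_sumZ -!weighted_sumD.
by apply: eq_weighted_sum => z; ring.
Qed.

Lemma hessian_sq_iterated f x :
  hessian_sq G f x = weighted_sum x (fun y =>
    weighted_sum y (fun z => (f x - 2 * f y + f z) ^+ 2)).
Proof.
rewrite /hessian_sq.
rewrite (_ : [set p | _] = nbhd G x `*`` nbhd G) //.
rewrite fsbig_setXR; [|exact: finite_nbhd|by move=> y _; exact: finite_nbhd].
rewrite /weighted_sum mulr_fsumr; apply: eq_fsbigr => y _.
rewrite !mulr_fsumr; apply: eq_fsbigr => z _ /=.
by rewrite real_normK ?num_real // invfM; ring.
Qed.

Lemma hessian_sqE f x :
  hessian_sq G f x =
  2 * weighted_sum x (Gamma G f f)
  - 2 * weighted_sum x (fun y => (f y - f x) * laplacian G f y)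
  + weighted_sum x (fun y => wdegree G y * (f y - f x) ^+ 2).
Proof.
rewrite hessian_sq_iterated -!weighted_sumZ -weighted_sumB -weighted_sumD.
apply: eq_weighted_sum => y.
by rewrite weighted_sum_second_difference; ring.
Qed.

(** Both [laplacian G (Gamma G f f) x] and [Gamma G f (laplacian G f) x] sum
    increments at [x]; the values at [x] itself factor out of these sums and
    give the two local terms. *)
Lemma Gamma2E f x :
  Gamma2 G f f x =
  2^-1 * (weighted_sum x (Gamma G f f)
          - weighted_sum x (fun y => (f y - f x) * laplacian G f y)
          + laplacian G f x ^+ 2 - wdegree G x * Gamma G f f x).
Proof.
rewrite /Gamma2 laplacianE weighted_sumB weighted_sum_cst.
have -> : Gamma G f (laplacian G f) x =
    2^-1 * (weighted_sum x (fun y => (f y - f x) * laplacian G f y)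
            - laplacian G f x ^+ 2).
  have -> : laplacian G f x ^+ 2 =
      laplacian G f x * weighted_sum x (fun y => f y - f x) by [].
  rewrite GammaE.
  rewrite -weighted_sumZ -weighted_sumB; congr (_ * _).
  by apply: eq_weighted_sum => y; ring.
by field.
Qed.

Lemma degree_correctionE f x :
  \sum_(y \in nbhd G x)
    eweight G x y / vweight G x * (wdegree G x + wdegree G y)
    * `|f y - f x| ^+ 2 =
  2 * wdegree G x * Gamma G f f x
  + weighted_sum x (fun y => wdegree G y * (f y - f x) ^+ 2).
Proof.
rewrite GammaE mulrA (mulrC 2) mulfK ?pnatr_eq0 // -weighted_sumZ.
rewrite -weighted_sumD /weighted_sum mulr_fsumr; apply: eq_fsbigr => y _.
by rewrite real_normK ?num_real //; ring.
Qed.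

End GammaCalculus.

Theorem proposition1p1 (R : realType) (V : choiceType)
    (G : weighted_graph R V) (f : V -> R) (x : V) :
  Gamma2 G f f x =
    4^-1 * hessian_sq G f x + 2^-1 * laplacian G f x ^+ 2
    - 4^-1 * \sum_(y \in nbhd G x)
        eweight G x y / vweight G x * (wdegree G x + wdegree G y)
        * `|f y - f x| ^+ 2.
Proof.
by rewrite Gamma2E hessian_sqE degree_correctionE; field.
Qed.
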